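(* Let $K\ge 3$ and $D\ge 1$ be integers. For real $x$ let $x \bmod 1 \triangleq x-\lfloor x+\tfrac12\rfloor\in[-\tfrac12,\tfrac12)$, applied entrywise to vectors. Let $\mathbf{N}_1,\dots,\mathbf{N}_{K-1}$ be i.i.d. uniform on $[-\tfrac12,\tfrac12)^D$, and let $\mathbf{G}_S\in\mathbb{Z}^{K\times (K-1)}$ be an integer matrix such that any $K-1$ of its rows form a full-rank matrix and $\mathbf{1}_K^\top\mathbf{G}_S=\mathbf{0}^\top$. Define secret keys by $[\mathbf{S}_1;\dots;\mathbf{S}_K]=\mathbf{G}_S[\mathbf{N}_1;\dots;\mathbf{N}_{K-1}] \bmod 1$ (so that $[\sum_k \mathbf{S}_k]\bmod 1=\mathbf{0}$). Let $\mathbf{W}_1,\dots,\mathbf{W}_K\in\mathbb{R}^D$ be random private messages, independent of the keys, with $\mathbf{W}\triangleq\sum_{k=1}^K\mathbf{W}_k\in[-a,a]^D$ for some $0<a<\tfrac12$. Each client $k$ forms $\mathbf{e}_k=[\mathbf{W}_k+\mathbf{S}_k]\bmod 1$ and broadcasts $\mathbf{x}_k=\frac{\sqrt{P}}{h_k}\mathbf{e}_k$, with $P>0$ and $h_k\in\mathbb{R}\setminus\{0\}$. Fix a client $k$. For each $k'\ne k$, client $k$ receives $\mathbf{y}_{k,k'}=h_{k,k'}\mathbf{x}_{k'}+\mathbf{z}_{k,k'}$, where $h_{k,k'}$ is a channel coefficient and $\mathbf{z}_{k,k'}\sim\mathcal{N}(\mathbf{0},N_0\mathbf{I}_D)$ is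 receiver noise; assume the channel coefficients and noises are independent of the messages and keys. Then $$I\big(\{\mathbf{W}_{k'}\}_{k'\neq k};\{\mathbf{y}_{k,k'}\}_{k'\neq k}\,\big|\,\mathbf{W}_k,\mathbf{S}_k,\mathbf{W}\big)=0.$$
   Context: This is the P$^2$-AirComp protocol, considered against an honest-but-curious client $k$ that uses its own message $\mathbf{W}_k$ and key $\mathbf{S}_k$ as side information when overhearing the broadcasts of other clients. $I(\cdot;\cdot\mid\cdot)$ denotes conditional mutual information. *)

(* Defs.v *)
From HB Require Import structures.
From mathcomp Require Import all_boot all_order all_algebra.
From mathcomp Require Import all_classical all_reals all_analysis.
Set Implicit Arguments. Unset Strict Implicit. Unset Printing Implicit Defensive.
Import Order.TTheory GRing.Theory Num.Theory.
Local Open Scope classical_set_scope.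
Local Open Scope ring_scope.

Section Defs.
Context {R : realType} {dT : measure_display} {T : measurableType dT}.
Variable (P : probability T R).

Definition Pr (A : set T) : R := fine (P A).

Definition modone (x : R) : R := x - (Num.floor (x + 2^-1))%:~R.

Definition rvsets (I : Type) (X : I -> T -> R) : set (set T) :=
  [set B | exists i (A : set R), measurable A /\ B = X i @^-1` A].
Definition sigma_of (I : Type) (X : I -> T -> R) : set (set T) :=
  <<s rvsets X >>.

Definition indep_sigma (F1 F2 : set (set T)) : Prop :=
  forall A B, F1 A -> F2 B -> Pr (A `&` B) = Pr A * Pr B.

Definition mutually_indep (I : eqType) (X : I -> T -> R) : Prop :=
  forall (J : seq I) (A : I -> set R), uniq J -> (forall i, measurable (A i)) ->
    Pr (\big[setI/setT]_(i <- J) (X i @^-1` A i)) =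
    \prod_(i <- J) Pr (X i @^-1` A i).

Definition unif_half (X : T -> R) : Prop :=
  forall A : set R, measurable A ->
    Pr (X @^-1` A) = fine (lebesgue_measure (A `&` `[(- 2^-1) , 2^-1[%classic)).

Definition normal_law (m v : R) (X : T -> R) : Prop :=
  forall A : set R, measurable A ->
    Pr (X @^-1` A) = fine (normal_prob m (Num.sqrt v) A).

(* ---- Shannon (conditional) mutual information for general random variables,
   via finite measurable partitions (Dobrushin / Wyner definition). ---- *)

Definition is_fpart (F : set (set T)) (n : nat) (p : nat -> set T) : Prop :=
  [/\ forall i, (i < n)%N -> F (p i),
      forall i j, (i < j)%N -> (j < n)%N -> p i `&` p j = set0 &
      \big[setU/set0]_(i < n) p i = setT].

Definition mi_term (pab pa pb : R) : R :=
  if pab == 0 then 0 else pab * ln (pab / (pa * pb)).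

Definition mi_disc (n : nat) (p : nat -> set T) (m : nat) (q : nat -> set T) : R :=
  \sum_(i < n) \sum_(j < m) mi_term (Pr (p i `&` q j)) (Pr (p i)) (Pr (q j)).

Definition mi_part (n : nat) (p : nat -> set T) (G : set (set T)) : \bar R :=
  ereal_sup [set (mi_disc n p mq.1 mq.2)%:E | mq in
     [set mq : nat * (nat -> set T) | is_fpart G mq.1 mq.2]].

Definition join_part (m : nat) (q : nat -> set T) (FZ : set (set T)) :
    set (set T) :=
  <<s [set B | exists2 j, (j < m)%N & B = q j] `|` FZ >>.

(* I(F_X ; F_Y | F_Z) :=
     sup over finite partitions alpha of F_X and beta of F_Y of
     I(alpha ; sigma(beta, F_Z)) - I(alpha ; F_Z).
   (I(alpha ; .) <= H(alpha) < +oo, so the difference is well defined.) *)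
Definition cond_mutual_info (FX FY FZ : set (set T)) : \bar R :=
  ereal_sup [set (mi_part ab.1.1 ab.1.2 (join_part ab.2.1 ab.2.2 FZ)
                  - mi_part ab.1.1 ab.1.2 FZ)%E
            | ab in [set ab : (nat * (nat -> set T)) * (nat * (nat -> set T)) |
                       is_fpart FX ab.1.1 ab.1.2 /\ is_fpart FY ab.2.1 ab.2.2]].

End Defs.

(* Main.v *)
Require Import Defs.
From HB Require Import structures.
From mathcomp Require Import all_boot all_order all_algebra.
From mathcomp Require Import all_classical all_reals all_analysis.
From mathcomp Require Import measurable_realfun lra.
Set Implicit Arguments. Unset Strict Implicit. Unset Printing Implicit Defensive.
Import Order.TTheory GRing.Theory Num.Theory.
Import numFieldTopology.Exports.
Local Open Scope classical_set_scope.
Local Open Scope ring_scope.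

(** Fix a client [l != k].  The keys of all clients but [l] are the image modulo
    1 of uniform noise under an integer matrix that is invertible over the
    reals, so their joint law is invariant under translation modulo 1.  Hence
    [U], made of [S_k] and of the masked messages [e_j] for [j != k, l], is
    independent of all the messages, and so is [U] together with the channel
    coefficients and the noises.  As the keys sum to 0 modulo 1, [e_l] is a
    function of [U], [W_k] and the sum [W]; all received signals are thus
    functions of [U], the channels and [(W_k, W)], and the conditional
    probability of an event about the messages given them and [(W_k, S_k, W)]
    only depends on [(W_k, W)].

    For the mutual information, the level sets of these conditional
    probabilities give finite partitions, measurable with respect to the
    conditioning variables, which up to an arbitrarily small error are as
    informative as any partition that also involves the received signals. *)

(** * Mutual information of finite partitions *)

Lemma ln_le_subr1 {R : realType} (x : R) : 0 < x -> ln x <= x - 1.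
Proof.
move=> x0; have := @le_ln1Dx R (x - 1); rewrite [1 + _]addrC subrK; apply; lra.
Qed.

(** Splits the difference at [ln (s + e)] and applies [ln t <= t - 1] to each half; the last
    hypothesis bounds [x * (r / (s + e))] by [r * b]. In the application [r] and [s] are the
    conditional probabilities of [i] given [j] and given [l], while [x] and [b] are the masses of
    [(i, j, l)] and [(j, l)]. *)
Lemma ln_ratio_bound {R : realType} (x b r s e : R) :
  0 < x -> 0 < r -> 0 < s -> 0 < e -> x <= (s + e) * b ->
  x * (ln r - ln s) <= r * b - x + e * (x / s).
Proof.
move=> x0 r0 s0 e0 xb; have se0 : 0 < s + e by lra.
have h1 : ln r - ln (s + e) <= r / (s + e) - 1.
  by rewrite -ln_div ?posrE//; apply: ln_le_subr1; exact: divr_gt0.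
have h2 : ln (s + e) - ln s <= e / s.
  rewrite -ln_div ?posrE//; apply: (le_trans (ln_le_subr1 _)).
    exact: divr_gt0.
  by rewrite mulrDl divff ?gt_eqF//; lra.
have h3 : x * (r / (s + e)) <= r * b.
  by rewrite mulrCA ler_wpM2l// ?(ltW r0)// ler_pdivrMr// mulrC.
have h4 : x * (ln r - ln s) <= x * (r / (s + e) - 1 + e / s).
  by rewrite ler_pM2l//; lra.
apply: (le_trans h4).
have -> : e * (x / s) = x * (e / s) by rewrite mulrCA.
lra.
Qed.

Section finite_information.
Context {R : realType} {I J L : finType}.
Variables (x : I -> J -> L -> R) (e : R).
Hypothesis x_ge0 : forall i j l, 0 <= x i j l.
Hypothesis e_gt0 : 0 < e.

Let xi i := \sum_j \sum_l x i j l.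
Let xj j := \sum_i \sum_l x i j l.
Let xl l := \sum_i \sum_j x i j l.
Let xij i j := \sum_l x i j l.
Let xil i l := \sum_j x i j l.
Let xjl j l := \sum_i x i j l.

(** For [x] the joint mass of [(i, j, l)], this reads P(i | j, l) <= P(i | l) + e, cleared of
    denominators so as to make sense on null cells too. *)
Hypothesis x_le : forall i j l,
  x i j l * xl l <= (xil i l + e * xl l) * xjl j l.

Let xij_ge0 i j : 0 <= xij i j. Proof. exact: sumr_ge0. Qed.
Let xil_ge0 i l : 0 <= xil i l. Proof. exact: sumr_ge0. Qed.
Let xjl_ge0 j l : 0 <= xjl j l. Proof. exact: sumr_ge0. Qed.
Let xi_ge0 i : 0 <= xi i. Proof. by apply: sumr_ge0 => j _; apply: sumr_ge0. Qed.
Let xj_ge0 j : 0 <= xj j. Proof. by apply: sumr_ge0 => i _; apply: sumr_ge0. Qed.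
Let xl_ge0 l : 0 <= xl l. Proof. by apply: sumr_ge0 => i _; apply: sumr_ge0. Qed.

Let ler_bigD1 (S : finType) (F : S -> R) s :
  (forall s, 0 <= F s) -> F s <= \sum_s F s.
Proof. by move=> F0; rewrite (bigD1 s)//= lerDl sumr_ge0. Qed.

Let xij_le_xi i j : xij i j <= xi i.
Proof. exact: (ler_bigD1 j (xij_ge0 i)). Qed.
Let xij_le_xj i j : xij i j <= xj j.
Proof. exact: (ler_bigD1 i (fun i => xij_ge0 i j)). Qed.
Let xil_le_xl i l : xil i l <= xl l.
Proof. exact: (ler_bigD1 i (fun i => xil_ge0 i l)). Qed.
Let xil_le_xi i l : xil i l <= xi i.
Proof. by rewrite /xi exchange_big/=; exact: (ler_bigD1 l (xil_ge0 i)). Qed.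
Let x_le_xij i j l : x i j l <= xij i j.
Proof. exact: (ler_bigD1 l (x_ge0 i j)). Qed.
Let x_le_xil i j l : x i j l <= xil i l.
Proof. exact: (ler_bigD1 j (fun j => x_ge0 i j l)). Qed.

(** Both kinds of terms are spread over the triples [(i, j, l)], so that the two informations can be
    compared termwise; the common [ln (xi i)] then cancels. *)
Let mi_term_xij i j : mi_term (xij i j) (xi i) (xj j) =
  \sum_l x i j l * (ln (xij i j / xj j) - ln (xi i)).
Proof.
rewrite -mulr_suml -/(xij i j) /mi_term; case: eqP => [->|/eqP h].
  by rewrite mul0r.
have h0 : 0 < xij i j by rewrite lt_neqAle eq_sym h xij_ge0.
have hi := lt_le_trans h0 (xij_le_xi i j).
have hj := lt_le_trans h0 (xij_le_xj i j).
congr (_ * _); rewrite -ln_div ?posrE ?divr_gt0//; congr ln.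
by rewrite invfM; lra.
Qed.

Let mi_term_xil i l : mi_term (xil i l) (xi i) (xl l) =
  \sum_j x i j l * (ln (xil i l / xl l) - ln (xi i)).
Proof.
rewrite -mulr_suml -/(xil i l) /mi_term; case: eqP => [->|/eqP h].
  by rewrite mul0r.
have h0 : 0 < xil i l by rewrite lt_neqAle eq_sym h xil_ge0.
have hi := lt_le_trans h0 (xil_le_xi i l).
have hl := lt_le_trans h0 (xil_le_xl i l).
congr (_ * _); rewrite -ln_div ?posrE ?divr_gt0//; congr ln.
by rewrite invfM; lra.
Qed.

Let pointwise i j l :
  x i j l * (ln (xij i j / xj j) - ln (xil i l / xl l)) <=
  xij i j / xj j * xjl j l - x i j l + e * (x i j l / (xil i l / xl l)).
Proof.
have [h|h] := leP (x i j l) 0.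
  have -> : x i j l = 0 by apply/eqP; rewrite eq_le h x_ge0.
  by rewrite !mul0r mulr0 subr0 addr0 mulr_ge0// divr_ge0.
have hij := lt_le_trans h (x_le_xij i j l).
have hil := lt_le_trans h (x_le_xil i j l).
have hj := lt_le_trans hij (xij_le_xj i j).
have hl := lt_le_trans hil (xil_le_xl i l).
apply: ln_ratio_bound => //; rewrite ?divr_gt0//.
rewrite -(ler_pM2r hl); apply: (le_trans (x_le i j l)).
by rewrite mulrAC [in leRHS]mulrDl divfK ?gt_eqF// lexx.
Qed.

(* If, within each cell [l], knowing [j] raises the conditional probability of
   [i] by at most [e], then [j] is at most [#|I| * e] nats more informative on
   [i] than [l]; only [ln t <= t - 1] is needed. *)
Lemma mi_sum_le :
  \sum_i \sum_j mi_term (xij i j) (xi i) (xj j) <=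
  \sum_i \sum_l mi_term (xil i l) (xi i) (xl l) + #|I|%:R * (e * \sum_l xl l).
Proof.
rewrite -lerBlDl -sumrB.
under eq_bigr => i _.
  under [X in X - _]eq_bigr do rewrite mi_term_xij.
  under [X in _ - X]eq_bigr do rewrite mi_term_xil.
  rewrite [X in _ - X]exchange_big/= -sumrB.
  under eq_bigr => j _.
    rewrite -sumrB.
    under eq_bigr => l _.
      rewrite -mulrBr opprB addrA subrK.
      over.
    over.
  over.
have -> : #|I|%:R * (e * \sum_l xl l) = \sum_(i : I) (e * \sum_l xl l).
  by rewrite sumr_const mulr_natl.
apply: ler_sum => i _.
apply: (@le_trans _ _ (\sum_j \sum_l (xij i j / xj j * xjl j l - x i j l +
   e * (x i j l / (xil i l / xl l))))).
  by apply: ler_sum => j _; apply: ler_sum => l _; exact: pointwise.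
under eq_bigr => j _ do rewrite big_split/= sumrB -mulr_sumr.
(* Summed over [l], the first part is [xij i j / xj j * xj j - xij i j], at most 0; in the second,
   the sum over [j] leaves at most [e * xl l] for each [l]. *)
rewrite big_split/= -[leRHS]add0r; apply: lerD.
  rewrite sumr_le0// => j _; rewrite subr_le0.
  have -> : \sum_l xjl j l = xj j by rewrite /xj exchange_big.
  have [->|h] := eqVneq (xj j) 0; first by rewrite mulr0 xij_ge0.
  by rewrite divfK.
rewrite exchange_big/= mulr_sumr; apply: ler_sum => l _.
rewrite -mulr_sumr -mulr_suml -/(xil i l) ler_wpM2l ?(ltW e_gt0)//.
have [->|h] := eqVneq (xil i l) 0; first by rewrite mul0r xl_ge0.
by rewrite invfM invrK mulrA divff// mul1r.
Qed.

End finite_information.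

(** * Finite partitions of the probability space *)

Section finite_partitions.
Context {R : realType} {dT : measure_display} {T : measurableType dT}.
Variable P : probability T R.

Lemma PrE (A : set T) : measurable A -> P A = (Pr P A)%:E.
Proof. by move=> mA; rewrite /Pr fineK// fin_num_measure. Qed.

Lemma Pr_ge0 (A : set T) : 0 <= Pr P A.
Proof. by rewrite /Pr fine_ge0. Qed.

Lemma Pr_setT : Pr P setT = 1.
Proof. by rewrite /Pr probability_setT. Qed.

Lemma Pr_fpart (B : set T) m q : measurable B -> is_fpart measurable m q ->
  Pr P B = \sum_(j < m) Pr P (B `&` q j).
Proof.
move=> mB [mq dq Uq]; apply: EFin_inj; rewrite -PrE// -sumEFin.
rewrite -[in LHS](setIT B) -Uq big_distrr/=.
have mBq k : (k < m)%N -> measurable (B `&` q k).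
  by move=> km; apply: measurableI => //; exact: mq.
rewrite (@measure_semi_additive_ord_I _ _ _ P (fun j => B `&` q j))//.
- by apply: eq_bigr => j _; exact/PrE/mBq.
- apply/trivIsetP => i j /= im jm ij; rewrite setIACA.
  have [lt|gt|/eqP] := ltngtP i j; last by rewrite (negPf ij).
    by rewrite dq// setI0.
  by rewrite (setIC (q i)) dq// setI0.
- by apply: bigsetU_measurable => i _; exact: mBq.
Qed.

Lemma is_fpart_sub (F G : set (set T)) n p :
  F `<=` G -> is_fpart F n p -> is_fpart G n p.
Proof. by move=> FG [Fp dp Up]; split => // i ni; exact/FG/Fp. Qed.

Lemma fpart_setT (F : set (set T)) : F setT -> is_fpart F 1 (fun=> setT).
Proof.
move=> FT; split=> //; last by rewrite big_ord1.
by move=> i j ij; rewrite ltnS leqn0 => /eqP j0; move: ij; rewrite j0.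
Qed.

(** This is [mi_sum_le] for the masses of the common refinement of [p], [q] and [D], whose total is
    1. *)
Lemma mi_disc_le n p m q N D (e : R) : 0 < e ->
  is_fpart measurable n p -> is_fpart measurable m q ->
  is_fpart measurable N D ->
  (forall i j l, (i < n)%N -> (j < m)%N -> (l < N)%N ->
    Pr P (p i `&` (q j `&` D l)) * Pr P (D l) <=
    (Pr P (p i `&` D l) + e * Pr P (D l)) * Pr P (q j `&` D l)) ->
  mi_disc P n p m q <= mi_disc P n p N D + n%:R * e.
Proof.
move=> e0 fp fq fD le.
have mp i : (i < n)%N -> measurable (p i) by case: fp => + _ _; apply.
have mq i : (i < m)%N -> measurable (q i) by case: fq => + _ _; apply.
have mD i : (i < N)%N -> measurable (D i) by case: fD => + _ _; apply.
pose x (i : 'I_n) (j : 'I_m) (l : 'I_N) := Pr P (p i `&` (q j `&` D l)).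
have xij i j : \sum_l x i j l = Pr P (p i `&` q j).
  rewrite (Pr_fpart _ fD); last by apply: measurableI; [exact: mp|exact: mq].
  by apply: eq_bigr => l _; rewrite /x setIA.
have xil i l : \sum_j x i j l = Pr P (p i `&` D l).
  rewrite (Pr_fpart _ fq); last by apply: measurableI; [exact: mp|exact: mD].
  by apply: eq_bigr => j _; rewrite /x (setIC (q j)) setIA.
have xjl j l : \sum_i x i j l = Pr P (q j `&` D l).
  rewrite (Pr_fpart _ fp); last by apply: measurableI; [exact: mq|exact: mD].
  by apply: eq_bigr => i _; rewrite /x setIC.
have xi i : \sum_j \sum_l x i j l = Pr P (p i).
  by under eq_bigr do rewrite xij; rewrite -Pr_fpart//; exact: mp.
have xj j : \sum_i \sum_l x i j l = Pr P (q j).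
  under eq_bigr do rewrite xij setIC.
  by rewrite -Pr_fpart//; exact: mq.
have xl l : \sum_i \sum_j x i j l = Pr P (D l).
  under eq_bigr do rewrite xil setIC.
  by rewrite -Pr_fpart//; exact: mD.
have := @mi_sum_le R 'I_n 'I_m 'I_N x e (fun i j l => Pr_ge0 _) e0.
under eq_bigr do under eq_bigr do rewrite xij xi xj.
under [X in (_ -> _ <= X + _) -> _]eq_bigr do under eq_bigr do rewrite xil xi xl.
rewrite card_ord.
under [X in (_ -> _ <= _ + _ * (_ * X)) -> _]eq_bigr do rewrite xl.
have -> : \sum_(l < N) Pr P (D l) = 1.
  by rewrite -Pr_setT (Pr_fpart _ fD)//; apply: eq_bigr => l _; rewrite setTI.
rewrite mulr1; apply => i j l; rewrite xl xil xjl; exact: le.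
Qed.

(** Renumbers a finite family by an initial segment of [nat], as [is_fpart] expects; indices past
    the end get the empty set. *)
Definition nat_cells (L : finType) (D : L -> set T) (n : nat) : set T :=
  if insub n is Some i then D (@enum_val L predT i) else set0.

Lemma is_fpart_fintype (F : set (set T)) (L : finType) (D : L -> set T) :
  (forall l, F (D l)) -> (forall l l', l != l' -> D l `&` D l' = set0) ->
  (forall t, exists l, D l t) ->
  is_fpart F #|L| (nat_cells D).
Proof.
move=> FD dD cD; split.
- by move=> i iL; rewrite /nat_cells insubT.
- move=> i j ij jL; rewrite /nat_cells (insubT (fun x => (x < _)%N) jL).
  rewrite (insubT (fun x => (x < _)%N) (ltn_trans ij jL)).
  apply: dD; apply/eqP => /enum_val_inj/(congr1 val)/= eij.
  by rewrite eij ltnn in ij.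
- apply/seteqP; split=> // t _; have [l Dl] := cD t.
  rewrite -bigcup_mkord; exists (enum_rank l); first exact: ltn_ord.
  by rewrite /nat_cells valK enum_rankK.
Qed.

End finite_partitions.

(** * Restriction of a measure to a sub-sigma-algebra *)

Section sub_sigma_algebra.
Context {R : realType} {dT : measure_display} {T : measurableType dT}.

(** The same set function on another measurable structure over [T]; the argument [mG] is what the
    measure instance below is built from. *)
Definition submeasure (m : {finite_measure set T -> \bar R}) (G : set (set T))
  (mG : G `<=` measurable) : set (g_sigma_algebraType G) -> \bar R := m.

Variables (m : {finite_measure set T -> \bar R}) (G : set (set T)).
Hypothesis mG : G `<=` measurable.

Lemma g_sigma_algebra_sub : <<s G >> `<=` measurable.
Proof. by apply: smallest_sub => //; exact: sigma_algebra_measurable. Qed.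

Lemma measurable_fun_to_sub :
  measurable_fun setT (id : T -> g_sigma_algebraType G).
Proof. by move=> _ A mA; rewrite setTI; exact: g_sigma_algebra_sub. Qed.

Lemma measurable_fun_sub d (U : sigmaRingType d) (f : T -> U) :
  measurable_fun (setT : set (g_sigma_algebraType G)) f ->
  measurable_fun (setT : set T) f.
Proof.
move=> mf _ A mA; apply: g_sigma_algebra_sub.
exact: (mf (@measurableT _ (g_sigma_algebraType G)) A mA).
Qed.

Local Notation sm := (submeasure m mG).

Let sm0 : sm set0 = 0%E. Proof. exact: measure0. Qed.
Let sm_ge0 A : (0 <= sm A)%E. Proof. exact: measure_ge0. Qed.
Let sm_sigma_additive : semi_sigma_additive sm.
Proof.
move=> F mF tF mUF; apply: (@measure_semi_sigma_additive _ _ _ m) => //.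
  by move=> n; exact: g_sigma_algebra_sub (mF n).
exact: g_sigma_algebra_sub mUF.
Qed.
HB.instance Definition _ :=
  isMeasure.Build _ _ _ sm sm0 sm_ge0 sm_sigma_additive.

Let sm_fin : fin_num_fun sm.
Proof. by move=> A mA; apply: fin_num_measure; exact: g_sigma_algebra_sub. Qed.
HB.instance Definition _ := Measure_isFinite.Build _ _ _ sm sm_fin.

(** The restricted measure is the pushforward of [m] by the identity, which is measurable towards
    the coarser structure. *)
Lemma ge0_integral_submeasure D (f : T -> \bar R) : <<s G >> D ->
  measurable_fun setT (f : g_sigma_algebraType G -> \bar R) ->
  (forall x, 0 <= f x)%E ->
  (\int[sm]_(x in D) f x = \int[m]_(x in D) f x)%E.
Proof.
move=> GD mf f0.
have := @ge0_integral_pushforward _ _ T (g_sigma_algebraType G) R id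
  measurable_fun_to_sub m D f GD (measurable_funTS mf) (fun y _ => f0 y).
exact.
Qed.

End sub_sigma_algebra.

(** * Independence and conditional probabilities *)

Section independence.
Context {R : realType} {dT : measure_display} {T : measurableType dT}.
Variables (P : probability T R) (G1 G2 : set (set T)).
Hypotheses (mG1 : G1 `<=` measurable) (mG2 : G2 `<=` measurable).
Hypothesis indep12 : indep_sigma P <<s G1 >> <<s G2 >>.

Local Notation T1 := (g_sigma_algebraType G1).
Local Notation T2 := (g_sigma_algebraType G2).
Local Notation P1 := (submeasure P mG1).
Local Notation P2 := (submeasure P mG2).

Let diag : T -> T1 * T2 := fun t => (t, t).

Let mdiag : measurable_fun setT diag.
Proof. by apply: measurable_fun_pair; exact: measurable_fun_to_sub. Qed.

Let diag_mfun : {mfun T >-> (T1 * T2)%type} :=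
  HB.pack diag (isMeasurableFun.Build _ _ _ _ _ mdiag).

(** The right-hand side is the law of the diagonal map. By independence it agrees with the product
    measure on rectangles, which determine it. *)
Lemma indep_product_measure (X : set (T1 * T2)) : measurable X ->
  (P1 \x P2)%E X = P [set t | X (t, t)].
Proof.
move=> mX; rewrite (@product_measure_unique _ _ T1 T2 R P1 P2
  (distribution P diag_mfun))// => A B mA mB.
have mA' : dT.-measurable A := g_sigma_algebra_sub mG1 mA.
have mB' : dT.-measurable B := g_sigma_algebra_sub mG2 mB.
rewrite [LHS](_ : _ = P (A `&` B))// PrE; last exact: measurableI.
by rewrite indep12// EFinM -!PrE.
Qed.

Lemma ge0_indep_integral (f : T1 * T2 -> \bar R) : measurable_fun setT f ->
  (forall z, 0 <= f z)%E ->
  (\int[P]_t f (t, t) = \int[P1]_x \int[P2]_y f (x, y))%E.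
Proof.
move=> mf f0; rewrite -[RHS](@fubini_tonelli1 _ _ T1 T2 R P1 P2 f mf f0).
rewrite (eq_measure_integral (distribution P diag_mfun)); last first.
  by move=> A mA _; rewrite [LHS]indep_product_measure.
by rewrite [in RHS]ge0_integral_pushforward.
Qed.

(** Tonelli applied to [\1_C1 x * (f \_ C2) y], whose restriction to the diagonal is the
    integrand. *)
Lemma ge0_indep_integral_setI (f : T -> \bar R) C1 C2 :
  <<s G1 >> C1 -> <<s G2 >> C2 -> measurable_fun setT (f : T2 -> \bar R) ->
  (forall x, 0 <= f x)%E ->
  (\int[P]_(x in C1 `&` C2) f x = P C1 * \int[P]_(x in C2) f x)%E.
Proof.
move=> GC1 GC2 mf f0.
have mC1 : dT.-measurable C1 := g_sigma_algebra_sub mG1 GC1.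
have mC2 : dT.-measurable C2 := g_sigma_algebra_sub mG2 GC2.
pose g (z : T1 * T2) : \bar R := ((\1_C1 z.1)%:E * (f \_ C2) z.2)%E.
have mfC2 : measurable_fun setT (f \_ C2 : T2 -> \bar R).
  exact: (@measurable_restrictT _ _ T2 _ C2 f GC2).1 (measurable_funTS mf).
have mg : measurable_fun setT g.
  apply: emeasurable_funM.
    apply/measurable_EFinP; apply: measurableT_comp; last exact: measurable_fst.
    exact: (@measurable_indic _ T1 R setT C1).
  by apply: (measurableT_comp mfC2); exact: measurable_snd.
have fC20 x : (0 <= (f \_ C2) x)%E by rewrite patchE; case: ifP.
have g0 z : (0 <= g z)%E by rewrite mule_ge0// lee_fin.
transitivity (\int[P]_t g (t, t))%E.
  rewrite integral_mkcond; apply: eq_integral => t _.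
  rewrite /g /= !patchE indicE in_setI; case: (t \in C1) => /=.
    by rewrite mul1e.
  by rewrite mul0e.
rewrite ge0_indep_integral//.
transitivity (\int[P1]_x ((\1_C1 x)%:E * \int[P2]_y (f \_ C2) y))%E.
  apply: eq_integral => x _; rewrite /g /=.
  by apply: (@ge0_integralZl _ T2 R P2 setT) => //; rewrite lee_fin.
transitivity ((\int[P1]_x (\1_C1 x)%:E) * \int[P2]_y (f \_ C2) y)%E.
  apply: (@ge0_integralZr _ T1 R P1 setT) => //.
  - by apply/measurable_EFinP; exact: (@measurable_indic _ T1 R setT C1).
  - exact: integral_ge0.
rewrite (@integral_indic _ T1)// setIT -(@integral_mkcond _ T2 R P2 C2 f).
by rewrite ge0_integral_submeasure.
Qed.

End independence.

Lemma measure_density {R : realType} d (T : measurableType d)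
    (mu : {measure set T -> \bar R}) (f : T -> \bar R) :
  measurable_fun setT f -> (forall x, 0 <= f x)%E ->
  {m : {measure set T -> \bar R} |
    forall C, m C = (\int[mu]_(x in C) f x)%E}.
Proof.
move=> mf f0; pose m C := (\int[mu]_(x in C) f x)%E.
have m0 : m set0 = 0%E by exact: integral_set0.
have m_ge0 C : (0 <= m C)%E by exact: integral_ge0.
have msa : semi_sigma_additive m by exact: semi_sigma_additive_nng_induced.
pose mM := isMeasure.Build _ _ _ m m0 m_ge0 msa.
by exists (HB.pack m mM : {measure set T -> \bar R}).
Qed.

(** * Conditional probabilities given two independent sources *)

Section conditional_probability.
Context {R : realType} {dT : measure_display} {T : measurableType dT}.
Variables (P : probability T R) (WG LG HG : set (set T)).
Hypotheses (mWG : WG `<=` measurable) (mLG : LG `<=` measurable).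
Hypothesis HW : HG `<=` <<s WG >>.
Hypothesis indepLW : indep_sigma P <<s LG >> <<s WG >>.

(** A pi-system generating the join of the two sigma-algebras. *)
Definition rectangles : set (set T) :=
  [set C | exists C1 C2, [/\ <<s LG >> C1, <<s HG >> C2 & C = C1 `&` C2]].

Let mHG : HG `<=` measurable.
Proof. by move=> A /HW; exact: g_sigma_algebra_sub. Qed.

Let sHW : <<s HG >> `<=` <<s WG >>.
Proof. by apply: smallest_sub => //; exact: smallest_sigma_algebra. Qed.

Let indepLH : indep_sigma P <<s LG >> <<s HG >>.
Proof. by move=> A B LA HB; apply: indepLW => //; exact: sHW. Qed.

Let sT (G : set (set T)) : <<s G >> setT.
Proof. exact: (@measurableT _ (g_sigma_algebraType G)). Qed.

Let sI (G : set (set T)) A B : <<s G >> A -> <<s G >> B -> <<s G >> (A `&` B).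
Proof. exact: (@measurableI _ (g_sigma_algebraType G)). Qed.

Lemma rectangles_setI : setI_closed rectangles.
Proof.
move=> A B [A1 [A2 [LA1 HA2 ->]]] [B1 [B2 [LB1 HB2 ->]]].
by exists (A1 `&` B1), (A2 `&` B2); rewrite setIACA; split => //; exact: sI.
Qed.

Lemma rectangles_measurable : rectangles `<=` measurable.
Proof.
move=> A [A1 [A2 [LA1 HA2 ->]]].
by apply: measurableI; [exact: (g_sigma_algebra_sub mLG)|
  exact: (g_sigma_algebra_sub mHG)].
Qed.

Lemma rectanglesl A : <<s LG >> A -> <<s rectangles >> A.
Proof.
by move=> LA; apply: sub_sigma_algebra; exists A, setT; rewrite setIT; split.
Qed.

Lemma rectanglesr A : <<s HG >> A -> <<s rectangles >> A.
Proof.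
by move=> HA; apply: sub_sigma_algebra; exists setT, A; rewrite setTI; split.
Qed.

(* [f] is the conditional probability of [A] given [HG]; as [LG] is independent
   of [A] and [HG] together, it is also the one given [LG] and [HG]. *)
Lemma cond_density A : <<s WG >> A -> exists f : T -> \bar R,
  [/\ forall x, (0 <= f x)%E,
      measurable_fun setT (f : g_sigma_algebraType HG -> \bar R) &
      forall C, <<s rectangles >> C ->
        P (A `&` C) = (\int[P]_(x in C) f x)%E].
Proof.
move=> WA; have mA : measurable A := g_sigma_algebra_sub mWG WA.
(* [f] will be the Radon-Nikodym derivative of [E -> P (E & A)] with respect to [P], both restricted
   to [<<s HG >>]. *)
pose mu := submeasure P mHG; pose nu := submeasure (mrestr P mA) mHG.
have numu : nu `<< mu.
  apply/null_content_dominatesP => E mE muE0.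
  have mE' : dT.-measurable E := g_sigma_algebra_sub mHG mE.
  apply: (@subset_measure0 _ T R P (E `&` A) E) => //.
  exact: measurableI.
have [f [f0 /measurable_int mf nuE]] := radon_nikodym_finite numu.
exists f; split=> // C GC.
have mfT : measurable_fun (setT : set T) f := measurable_fun_sub mHG mf.
have [m2 m2E] := measure_density P mfT f0.
have <- : m2 C = (\int[P]_(x in C) f x)%E by rewrite m2E.
rewrite -[LHS](_ : mrestr P mA C = _); last by rewrite /mrestr setIC.
(* Both sides are measures in [C], so comparing them on the pi-system of rectangles is enough. *)
apply: (@g_sigma_algebra_measure_unique _ R T rectangles rectangles_measurable
  (fun=> setT)) => //.
- by move=> _; exists setT, setT; rewrite setIT; split.
- by rewrite bigcup_const//; exists 0%N.
- exact: rectangles_setI.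
- move=> _ [C1 [C2 [LC1 HC2 ->]]].
  (* [C1] is independent of [C2], which factors the integral, and also of [C2 & A], which factors
     the probability. *)
  rewrite m2E (ge0_indep_integral_setI mLG mHG indepLH)//.
  rewrite -(ge0_integral_submeasure P mHG HC2)// -nuE//.
  change (P (C1 `&` C2 `&` A) = P C1 * P (C2 `&` A))%E.
  have mC1 : measurable C1 := g_sigma_algebra_sub mLG LC1.
  have mC2 : measurable C2 := g_sigma_algebra_sub mHG HC2.
  rewrite -setIA !PrE//; try by do ?apply: measurableI.
  rewrite -EFinM indepLW//; apply: sI => //; exact: sHW.
- by move=> _; rewrite /mrestr ltey_eq fin_num_measure//; exact: measurableI.
Qed.


(** The conditional probabilities of the [p i] are discretised with step [1 / M <= e], and [D]
    consists of their joint level sets. On such a cell, the probabilities of [p i] given [D l] and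
    given [C & D l] lie in the same interval of length [1 / M]; the inequality states this without
    division. *)
Lemma cond_prob_cells n (p : nat -> set T) (e : R) : 0 < e ->
  (forall i, (i < n)%N -> <<s WG >> (p i)) ->
  exists N D, is_fpart <<s HG >> N D /\
    forall i l C, (i < n)%N -> (l < N)%N -> <<s rectangles >> C ->
      Pr P (p i `&` (C `&` D l)) * Pr P (D l) <=
      (Pr P (p i `&` D l) + e * Pr P (D l)) * Pr P (C `&` D l).
Proof.
move=> e0 Wp.
have [f /all_and3[f0 mf fE]] :=
  choice (fun i : 'I_n => cond_density (Wp i (ltn_ord i))).
pose M := (Num.truncn e^-1).+1.
have M0 : 0 < M%:R :> R by rewrite ltr0n.
have Me : M%:R^-1 <= e.
  by rewrite -[leRHS]invrK lef_pV2 ?posrE ?invr_gt0// ltW// truncnS_gt.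
(* The cell of index [M] has no upper bound, since [f i] is not known to be at most 1 everywhere. *)
pose cell (i : 'I_n) (l : 'I_M.+1) : set T := [set t |
  (((l%:R / M%:R)%:E <= f i t)%E /\
   ((l < M)%N -> (f i t < (l.+1%:R / M%:R)%:E)%E))].
pose D (g : {ffun 'I_n -> 'I_M.+1}) : set T :=
  \bigcap_(i in [set: 'I_n]) cell i (g i).
have Hcell i l : <<s HG >> (cell i l).
  have m1 : <<s HG >> [set t | ((l%:R / M%:R)%:E <= f i t)%E].
    have := emeasurable_fun_c_infty
      (@measurableT _ (g_sigma_algebraType HG)) (mf i) (l%:R / M%:R)%:E.
    by rewrite setTI.
  have m2 : <<s HG >> [set t | (f i t < (l.+1%:R / M%:R)%:E)%E].
    have := emeasurable_fun_infty_o
      (@measurableT _ (g_sigma_algebraType HG)) (mf i) (l.+1%:R / M%:R)%:E.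
    by rewrite setTI.
  have [lM|lM] := ltnP l M.
    rewrite (_ : cell i l = [set t | ((l%:R / M%:R)%:E <= f i t)%E] `&`
      [set t | (f i t < (l.+1%:R / M%:R)%:E)%E]); first exact: sI.
    by apply/seteqP; split=> t [? h]; split=> //; exact: h.
  rewrite (_ : cell i l = [set t | ((l%:R / M%:R)%:E <= f i t)%E])//.
  apply/seteqP; split=> t; first by case.
  by move=> h; split=> //; rewrite ltnNge lM.
have HD g : <<s HG >> (D g).
  apply: (@fin_bigcap_measurable _ (g_sigma_algebraType HG)) => //.
  by move=> i _; exact: Hcell.
have mp i : (i < n)%N -> measurable (p i).
  by move=> /Wp; exact: g_sigma_algebra_sub.
have mG := g_sigma_algebra_sub rectangles_measurable.
have bounds (i : 'I_n) l E : <<s rectangles >> E -> E `<=` cell i l ->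
    l%:R / M%:R * Pr P E <= Pr P (p i `&` E) <=
    (l%:R / M%:R + M%:R^-1) * Pr P E.
  move=> GE Ecell; have mE : measurable E := mG _ GE.
  have mpE : measurable (p i `&` E) by apply: measurableI => //; exact: mp.
  have mfE : measurable_fun E (f i).
    exact/measurable_funTS/(measurable_fun_sub mHG (mf i)).
  have lM0 (k : nat) : (0 <= (k%:R / M%:R : R)%:E)%E.
    by rewrite lee_fin divr_ge0.
  apply/andP; split.
    rewrite -lee_fin EFinM -!PrE// fE// -integral_cst//.
    apply: ge0_le_integral => //.
      by move=> x _; exact: lM0.
    by move=> x /Ecell[].
  (* In the last cell [l / M = 1], and the upper bound comes from [P (p i & E) <= P E]. *)
  have [lM|lM] := ltnP l M; last first.
    have -> : (l : nat) = M.
      by apply/eqP; rewrite eqn_leq lM andbT -ltnS ltn_ord.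
    rewrite divff ?gt_eqF//.
    apply: (@le_trans _ _ (Pr P E)).
      by rewrite -lee_fin -!PrE//; apply: le_measure; rewrite ?inE.
    by rewrite ler_peMl ?Pr_ge0// lerDl invr_ge0 ltW.
  have -> : l%:R / M%:R + M%:R^-1 = l.+1%:R / M%:R :> R.
    by rewrite -natr1 mulrDl mul1r.
  rewrite -lee_fin EFinM -!PrE// fE// -integral_cst//.
  apply: ge0_le_integral => //.
  by move=> x /Ecell[_ /(_ lM)/ltW].
exists #|{ffun 'I_n -> 'I_M.+1}|, (nat_cells D); split.
  apply: is_fpart_fintype => //.
    move=> g g' gg'; apply/seteqP; split=> // t [Dg Dg'].
    move/eqP: gg'; apply; apply/ffunP => i; apply/val_inj => /=.
    have [le lt] := Dg i I; have [le' lt'] := Dg' i I.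
    have aux (a b : 'I_M.+1) : ((a%:R / M%:R)%:E <= f i t)%E ->
      ((b < M)%N -> (f i t < (b.+1%:R / M%:R)%:E)%E) -> (a <= b)%N.
      move=> ha hb; rewrite leqNgt; apply/negP => ba.
      have bM : (b < M)%N by rewrite (leq_trans ba)// -ltnS.
      have := le_lt_trans ha (hb bM); rewrite lte_fin ltr_pM2r ?invr_gt0//.
      by rewrite ltr_nat ltnS leqNgt ba.
    by apply/eqP; rewrite eqn_leq !aux.
  move=> t.
  have ex i : exists l, cell i l t.
    have P0 : (((ord0 : 'I_M.+1)%:R / M%:R)%:E <= f i t)%E by rewrite mul0r.
    have [l hl lmax] := @arg_maxnP _ ord0
      (fun l : 'I_M.+1 => (l%:R / M%:R)%:E <= f i t)%E (fun l => l : nat) P0.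
    exists l; split=> // lM; rewrite ltNge; apply/negP => h.
    by have := lmax (Ordinal (lM : (l.+1 < M.+1)%N)) h; rewrite /= ltnn.
  have [g hg] := choice ex; exists [ffun i => g i] => i _.
  by rewrite ffunE.
move=> i l C ni lN GC; rewrite /nat_cells (insubT (fun x => (x < _)%N) lN).
set g := enum_val _; pose i' := Ordinal ni.
have Dc : D g `<=` cell i' (g i') by move=> t /(_ i' I).
(* The lower bound on [D g] and the upper bound on [C & D g] involve the same level, hence differ by
   [1 / M] only. *)
have /andP[b1 _] := bounds i' (g i') (D g) (rectanglesr (HD g)) Dc.
have /andP[_ b2] := bounds i' (g i') (C `&` D g)
  (sI GC (rectanglesr (HD g))) (subset_trans (@subIsetr _ _ _) Dc).
rewrite /= in b1 b2.
apply: (le_trans (ler_wpM2r (Pr_ge0 P (D g)) b2)).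
rewrite mulrAC ler_wpM2r ?Pr_ge0// mulrDl lerD// ler_wpM2r ?Pr_ge0//.
Qed.

End conditional_probability.

(** * Vanishing of the conditional mutual information *)

Section conditional_information.
Context {R : realType} {dT : measure_display} {T : measurableType dT}.
Variables (P : probability T R).

Lemma mi_part_setT (G : set (set T)) : G `<=` measurable -> G setT ->
  mi_part P 1 (fun=> setT) G = 0%E.
Proof.
move=> mG GT; rewrite /mi_part.
rewrite (_ : [set _ | _ in _] = [set 0%E]) ?ereal_sup1//.
have mi0 m q : mi_disc P 1 (fun=> setT) m q = 0.
  rewrite /mi_disc big_ord1 big1// => j _; rewrite setTI Pr_setT /mi_term mul1r.
  case: eqP => // /eqP h.
  by rewrite divff// ln1 mulr0.
apply/seteqP; split=> [_ [mq fmq <-]|_ ->]; first by rewrite mi0.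
by exists (1%N, fun=> setT); [exact: fpart_setT|rewrite mi0].
Qed.

Variables WG LG HG : set (set T).
Hypotheses (mWG : WG `<=` measurable) (mLG : LG `<=` measurable).
Hypothesis HW : HG `<=` <<s WG >>.
Hypothesis indepLW : indep_sigma P <<s LG >> <<s WG >>.

(** Any partition of the join of [q] and [FZ] lies in the sigma-algebra of rectangles, so the cells
    of [cond_prob_cells], which are available in [FZ], are as informative on [p] up to any positive
    error. Thus no difference in the supremum is positive. *)
Lemma cond_mutual_info_eq0 (FX FY FZ : set (set T)) :
  FX setT -> FY setT -> FZ setT ->
  FX `<=` <<s WG >> -> <<s HG >> `<=` FZ ->
  FY `<=` <<s rectangles LG HG >> -> FZ `<=` <<s rectangles LG HG >> ->
  cond_mutual_info P FX FY FZ = 0%E.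
Proof.
move=> XT YT ZT XW HZ YG ZG.
have mG : <<s rectangles LG HG >> `<=` measurable.
  exact: g_sigma_algebra_sub (rectangles_measurable mWG mLG HW).
have joinG m q : is_fpart FY m q ->
    join_part m q FZ `<=` <<s rectangles LG HG >>.
  move=> [Yq _ _]; apply: smallest_sub; first exact: smallest_sigma_algebra.
  move=> A [[j jm ->]|]; last exact: ZG.
  by apply: YG; exact: Yq.
apply/eqP; rewrite eq_le; apply/andP; split.
  apply: ge_ereal_sup => _ [[[n p] [m q]] /= [fp fq] <-].
  rewrite sube_le0; apply: ge_ereal_sup => _ [[m' q'] /= fq' <-].
  apply/lee_addgt0Pr => e e0.
  (* The error of [mi_disc_le] is [n] times this quantity, hence at most [e]; the successor keeps
     the divisor nonzero. *)
  have e'0 : 0 < e / n.+1%:R by rewrite divr_gt0.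
  have [N [D [fD le]]] := cond_prob_cells mWG mLG HW indepLW e'0
    (fun i ni => XW _ (let: And3 h _ _ := fp in h i ni)).
  have fpm : is_fpart measurable n p.
    by apply: is_fpart_sub fp => A /XW; exact: g_sigma_algebra_sub.
  have fq'm : is_fpart measurable m' q'.
    by apply: is_fpart_sub fq' => A /(joinG _ _ fq)/mG.
  have fDZ : is_fpart FZ N D by exact: is_fpart_sub fD.
  have fDm : is_fpart measurable N D.
    by apply: is_fpart_sub fDZ => A /ZG/mG.
  apply: (@le_trans _ _ ((mi_disc P n p N D)%:E + e%:E)%E); last first.
    by apply: leeD2r; apply: ereal_sup_ubound; exists (N, D).
  rewrite -EFinD lee_fin.
  apply: (le_trans (mi_disc_le e'0 fpm fq'm fDm _)).
    move=> i j l ni jm lN; apply: le => //.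
    by apply: (joinG _ _ fq); case: fq' => + _ _; apply.
  rewrite lerD2l mulrCA ler_piMr ?ltW// ltr_pdivrMr// mul1r ltr_nat//.
(* The value 0 is attained at the trivial partitions. *)
apply: ereal_sup_ubound.
have fY1 : is_fpart FY 1 (fun=> setT) by exact: fpart_setT.
exists ((1%N, fun=> setT), (1%N, fun=> setT)) => /=.
  by split=> //; exact: fpart_setT.
rewrite !mi_part_setT ?subee//.
- by move=> A /ZG/mG.
- by move=> A /(joinG _ _ fY1)/mG.
- exact: (@measurableT _ (g_sigma_algebraType _)).
Qed.

End conditional_information.

(** * Translation invariance modulo 1 *)

Section modone.
Context {R : realType}.
Implicit Types x y u : R.

Lemma modone_eq x y (n : int) : x = y + n%:~R -> modone x = modone y.
Proof.
move=> ->; rewrite /modone.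
have -> : y + n%:~R + 2^-1 = y + 2^-1 + n%:~R by lra.
by rewrite floorDrz ?intr_int// intrKfloor intrD; lra.
Qed.

Lemma modone_id x : - 2^-1 <= x < 2^-1 -> modone x = x.
Proof.
move=> /andP[x1 x2]; rewrite /modone.
have /eqP -> : Num.floor (x + 2^-1) == 0.
  by rewrite floor_eq mulr0z add0r mulr1z; apply/andP; split; lra.
by rewrite mulr0z subr0.
Qed.

Lemma modone_itv x : - 2^-1 <= modone x < 2^-1.
Proof.
have := floor_itv (x + 2^-1); rewrite intrD mulr1z /modone => /andP[h1 h2].
by apply/andP; split; lra.
Qed.

Lemma modone_int_diff x : exists n : int, modone x = x + n%:~R.
Proof. by exists (- Num.floor (x + 2^-1)); rewrite intrN. Qed.

Lemma modone_modoneD x y : modone (modone x + y) = modone (x + y).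
Proof. by have [n ->] := modone_int_diff x; apply: (modone_eq (n := n)); lra. Qed.

Lemma measurable_modone : measurable_fun setT (@modone R).
Proof.
apply: measurable_funB => //.
apply: nondecreasing_measurable => // x y xy.
by rewrite ler_int le_floor// lerD2r.
Qed.

Lemma lebesgue_measure_shift (A : set R) u : measurable A ->
  lebesgue_measure ((fun x => x + u) @^-1` A) = lebesgue_measure A.
Proof.
move=> mA.
have mu : measurable_fun setT ((fun x => x + u) : R -> measurableTypeR R).
  exact: measurable_funD.
pose s : {mfun R >-> measurableTypeR R} :=
  HB.pack ((fun x => x + u) : R -> measurableTypeR R)
    (isMeasurableFun.Build _ _ _ _ _ mu).
apply/esym.
apply: (lebesgue_measure_unique (mu := pushforward lebesgue_measure s)) => //.
move=> _ [[a b]] _ <-.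
change (lebesgue_measure `]a, b]%classic =
  lebesgue_measure ((fun x => x + u) @^-1` `]a, b]%classic)).
rewrite (_ : _ @^-1` _ = `]a - u, b - u]%classic); last first.
  by apply/seteqP; split=> x /=; rewrite !in_itv/= ltrBlDr lerBrDr.
rewrite !lebesgue_measure_itv/= !lte_fin ltrD2r; case: ifP => // _.
by rewrite -!EFinB; congr EFin; lra.
Qed.

(** Only the fractional part [w] of [u] matters. [A1] is the part of [A] reached without wrapping
    around and [A2] the part reached after subtracting 1; the preimage of each is a plain
    translate. *)
Lemma lebesgue_measure_modone_shift (A : set R) u : measurable A ->
  lebesgue_measure ((fun x => modone (x + u)) @^-1` A `&`
    `[- 2^-1, 2^-1[%classic) =
  lebesgue_measure (A `&` `[- 2^-1, 2^-1[%classic).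
Proof.
move=> mA.
pose w := u - (Num.floor u)%:~R.
have /andP[w0 w1] : 0 <= w < 1.
  have := floor_itv u; rewrite intrD mulr1z /w => /andP[h1 h2].
  by apply/andP; split; lra.
have uw x : modone (x + u) = modone (x + w).
  by apply: (modone_eq (n := Num.floor u)); rewrite /w; lra.
pose A1 := A `&` `[w - 2^-1, 2^-1[%classic.
pose A2 := A `&` `[- 2^-1, w - 2^-1[%classic.
have mA1 : measurable A1 by exact: measurableI.
have mA2 : measurable A2 by exact: measurableI.
have mshift c (B : set R) : measurable B -> measurable ((fun x => x + c) @^-1` B).
  move=> mB; rewrite -[X in measurable X]setTI.
  by apply: (measurable_funD (f := id) (g := cst c)).
have -> : A `&` `[- 2^-1, 2^-1[%classic = A1 `|` A2.
  rewrite -setIUr; congr (_ `&` _); apply/seteqP; split=> x /=;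
    rewrite !in_itv/=.
    move=> /andP[h1 h2]; have [h|h] := leP (w - 2^-1) x; [left|right];
      by apply/andP.
  by case=> /andP[h1 h2]; apply/andP; split; lra.
have -> : (fun x => modone (x + u)) @^-1` A `&` `[- 2^-1, 2^-1[%classic =
    (fun x => x + w) @^-1` A1 `|` (fun x => x + (w - 1)) @^-1` A2.
  apply/seteqP; split=> x; rewrite /A1 /A2 /= !in_itv/= uw.
    move=> [Ax /andP[h1 h2]]; have [h|h] := ltP (x + w) (2^-1); [left|right].
      have xw : modone (x + w) = x + w by apply: modone_id; apply/andP; split; lra.
      by rewrite xw in Ax; split=> //; apply/andP; split; lra.
    have xw : modone (x + w) = x + (w - 1).
      rewrite (@modone_eq (x + w) (x + (w - 1)) 1); last by rewrite mulr1z; lra.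
      by apply: modone_id; apply/andP; split; lra.
    by rewrite xw in Ax; split=> //; apply/andP; split; lra.
  case=> -[Ax /andP[h1 h2]].
    rewrite modone_id; first by split=> //; apply/andP; split; lra.
    by apply/andP; split; lra.
  rewrite (@modone_eq (x + w) (x + (w - 1)) 1); last by rewrite mulr1z; lra.
  rewrite modone_id; first by split=> //; apply/andP; split; lra.
  by apply/andP; split; lra.
rewrite !measureU//; try by exact: mshift.
- by congr (_ + _)%E; exact: lebesgue_measure_shift.
- apply/seteqP; split=> // x [] [_ /=] /[!in_itv]/= /andP[h1 h2] [_ /=].
  by rewrite in_itv/= => /andP[h3 h4]; lra.
- apply/seteqP; split=> // x [] [_ /=] /[!in_itv]/= /andP[h1 h2] [_ /=].
  by rewrite in_itv/= => /andP[h3 h4]; lra.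
Qed.

Lemma unif_half_modone_shift {d} {T : measurableType d} (P : probability T R)
    (X : T -> R) u : unif_half P X ->
  unif_half P (fun t => modone (X t + u)).
Proof.
move=> uX A mA; have := uX ((fun x => modone (x + u)) @^-1` A).
rewrite lebesgue_measure_modone_shift//; apply.
rewrite -[X in measurable X]setTI.
apply: (measurableT_comp measurable_modone (g := fun x => x + u)) => //.
exact: measurable_funD.
Qed.

End modone.

(** * Joint laws and masking *)

Section pi_system_independence.
Context {R : realType} {dT : measure_display} {T : measurableType dT}.
Variables (P : probability T R) (G F : set (set T)).
Hypotheses (mG : G `<=` measurable) (mF : F `<=` measurable).

(** For fixed [B], the maps [A -> P (A & B)] and [A -> P A * P B] are finite measures that agree on
    the pi-system [G]. *)
Lemma indep_sigma_pi_system : setI_closed G -> G setT ->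
  (forall A B, G A -> F B -> Pr P (A `&` B) = Pr P A * Pr P B) ->
  indep_sigma P <<s G >> F.
Proof.
move=> GI GT GF A B GA FB; have mB := mF FB.
have mA : measurable A := g_sigma_algebra_sub mG GA.
apply: EFin_inj; rewrite EFinM -!PrE//; last exact: measurableI.
pose k : {nonneg R} := NngNum (Pr_ge0 P B).
change (mrestr P mB A = P A * P B)%E.
transitivity (mscale k P A); last first.
  by rewrite muleC [P B]PrE.
apply: (@g_sigma_algebra_measure_unique _ R T G mG (fun=> setT)) => //.
- by rewrite bigcup_const//; exists 0%N.
- move=> C GC; have mC := mG GC.
  change (P (C `&` B) = (Pr P B)%:E * P C)%E.
  by rewrite !PrE//; [rewrite GF// EFinM muleC|exact: measurableI].
- by move=> _; rewrite /mrestr ltey_eq fin_num_measure//; exact: measurableI.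
Qed.

End pi_system_independence.

Section joint_law.
Context {R : realType} {dT : measure_display} {T : measurableType dT}.
Variables (P : probability T R) (I : finType).

(** The pi-system generating the product sigma-algebra on [I -> R], on which joint laws live. *)
Definition boxes : set (set (I -> R)) := [set B | exists A : I -> set R,
  (forall i, measurable (A i)) /\ B = [set x | forall i, A i (x i)]].

Lemma boxes_setI : setI_closed boxes.
Proof.
move=> _ _ [A [mA ->]] [B [mB ->]]; exists (fun i => A i `&` B i); split.
  by move=> i; exact: measurableI.
apply/seteqP; split=> x /=; first by move=> [hA hB] i; split.
by move=> h; split=> i; have [] := h i.
Qed.

Lemma boxes_setT : boxes setT.
Proof. by exists (fun=> setT); split=> //; apply/seteqP; split. Qed.

Lemma measurable_coord i :
  measurable_fun setT ((fun x => x i) : g_sigma_algebraType boxes -> R).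
Proof.
move=> _ A mA; rewrite setTI; apply: sub_sigma_algebra.
exists (fun j => if j == i then A else setT); split.
  by move=> j; case: ifP.
apply/seteqP; split=> x /=; last by move=> /(_ i); rewrite eqxx.
by move=> Ax j; case: eqP => // ->.
Qed.

Lemma measurable_forall d (U : measurableType d) (X : I -> U -> R)
    (A : I -> set R) : (forall i, measurable_fun setT (X i)) ->
  (forall i, measurable (A i)) -> measurable [set t | forall i, A i (X i t)].
Proof.
move=> mX mA.
rewrite (_ : [set _ | _] = \bigcap_(i in [set: I]) (X i @^-1` A i)).
  apply: fin_bigcap_measurable => // i _.
  by rewrite -[X in measurable X]setTI; exact: mX.
by apply/seteqP; split=> t /= h i; [move=> _; exact: h|exact: (h i Logic.I)].
Qed.

Lemma measurable_joint (X : I -> T -> R) :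
  (forall i, measurable_fun setT (X i)) ->
  measurable_fun setT ((fun t i => X i t) : T -> g_sigma_algebraType boxes).
Proof.
move=> mX.
apply: (@measurability _ _ T (g_sigma_algebraType boxes) setT _ boxes) => //.
move=> _ [_ [A [mA ->]] <-].
by rewrite setTI; exact: measurable_forall.
Qed.

Lemma joint_law_eq (X Y : I -> T -> R) :
  (forall i, measurable_fun setT (X i)) ->
  (forall i, measurable_fun setT (Y i)) ->
  (forall A : I -> set R, (forall i, measurable (A i)) ->
    P [set t | forall i, A i (X i t)] = P [set t | forall i, A i (Y i t)]) ->
  forall B, <<s boxes >> B ->
    P [set t | B (fun i => X i t)] = P [set t | B (fun i => Y i t)].
Proof.
move=> mX mY XY B GB.
pose jX : {mfun T >-> g_sigma_algebraType boxes} :=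
  HB.pack ((fun t i => X i t) : T -> g_sigma_algebraType boxes)
    (isMeasurableFun.Build _ _ _ _ _ (measurable_joint mX)).
pose jY : {mfun T >-> g_sigma_algebraType boxes} :=
  HB.pack ((fun t i => Y i t) : T -> g_sigma_algebraType boxes)
    (isMeasurableFun.Build _ _ _ _ _ (measurable_joint mY)).
change (distribution P jX B = distribution P jY B).
apply: (@measure_unique _ R (g_sigma_algebraType boxes) boxes (fun=> setT)) => //.
- exact: boxes_setI.
- by move=> _; exact: boxes_setT.
- by rewrite bigcup_const//; exists 0%N.
- by move=> _ [A [mA ->]]; exact: XY.
- by move=> _; rewrite ltey_eq fin_num_measure.
Qed.

Lemma mutually_indep_box (X : I -> T -> R) (A : I -> set R) :
  mutually_indep P X -> (forall i, measurable (A i)) ->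
  Pr P [set t | forall i, A i (X i t)] = \prod_i Pr P (X i @^-1` A i).
Proof.
move=> iX mA.
have := iX (index_enum I) A (index_enum_uniq I) mA => <-; congr (Pr P _).
rewrite -bigcap_seq; apply/seteqP; split=> t /= h i; first by move=> _; exact: h.
by apply: h => /=; rewrite mem_index_enum.
Qed.

Lemma mutually_indep_comp (X : I -> T -> R) (f : I -> R -> R) :
  (forall i, measurable_fun setT (f i)) -> mutually_indep P X ->
  mutually_indep P (fun i t => f i (X i t)).
Proof.
move=> mf iX J A uJ mA.
apply: (iX J (fun i => f i @^-1` A i) uJ) => i.
by rewrite -[X in measurable X]setTI; exact: mf.
Qed.

(** A coordinatewise shift preserves both independence and each uniform law, hence the probability
    of every box. *)
Lemma unif_joint_shift (X : I -> T -> R) (u : I -> R) :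
  (forall i, measurable_fun setT (X i)) ->
  mutually_indep P X -> (forall i, unif_half P (X i)) ->
  forall B, <<s boxes >> B ->
    P [set t | B (fun i => modone (X i t + u i))] =
    P [set t | B (fun i => X i t)].
Proof.
move=> mX iX uX.
have mf i : measurable_fun setT (fun x : R => modone (x + u i)).
  by apply: (measurableT_comp measurable_modone); exact: measurable_funD.
have mY i : measurable_fun setT (fun t => modone (X i t + u i)).
  exact: (measurableT_comp (mf i) (mX i)).
apply: joint_law_eq => // A mA.
rewrite !PrE//; try exact: measurable_forall.
rewrite (mutually_indep_box iX mA).
rewrite (mutually_indep_box (mutually_indep_comp mf iX) mA).
congr EFin; apply: eq_bigr => i _.
by rewrite (unif_half_modone_shift (u i) (uX i) (mA i)) (uX i _ (mA i)).
Qed.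

End joint_law.

Section masking.
Context {R : realType} {dT : measure_display} {T : measurableType dT}.
Variables (P : probability T R) (I : finType) (G1 G2 : set (set T)).
Hypotheses (mG1 : G1 `<=` measurable) (mG2 : G2 `<=` measurable).
Hypothesis indep12 : indep_sigma P <<s G1 >> <<s G2 >>.
Local Notation T1 := (g_sigma_algebraType G1).
Local Notation T2 := (g_sigma_algebraType G2).
Variables V S : I -> T -> R.
Hypothesis mV : forall i, measurable_fun setT (V i : T1 -> R).
Hypothesis mS : forall i, measurable_fun setT (S i : T2 -> R).
Hypothesis shiftS : forall (v : I -> R) (A : I -> set R),
  (forall i, measurable (A i)) ->
  P [set t | forall i, A i (modone (S i t + v i))] =
  P [set t | forall i, A i (S i t)].

(* One-time pad: given the message, the masked message has the law of the key,
   because the latter is invariant under translation modulo 1. *)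
Lemma masked_box (A : I -> set R) C : (forall i, measurable (A i)) ->
  <<s G1 >> C ->
  P ([set t | forall i, A i (modone (V i t + S i t))] `&` C) =
  (P [set t | forall i, A i (S i t)] * P C)%E.
Proof.
move=> mA GC.
pose X : set (T1 * T2) :=
  [set z | forall i, A i (modone (V i z.1 + S i z.2))] `&` (fst @^-1` C).
have mX : measurable X.
  apply: measurableI; last first.
    by rewrite -[X in measurable X]setTI; exact: measurable_fst.
  apply: (@measurable_forall _ I _ (T1 * T2)%type
    (fun i z => modone (V i z.1 + S i z.2))) => // i.
  apply: (measurableT_comp measurable_modone); apply: measurable_funD.
    exact: (measurableT_comp (mV i) measurable_fst).
  exact: (measurableT_comp (mS i) measurable_snd).
rewrite [LHS](_ : _ = P [set t | X (t, t)])//.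
rewrite -(indep_product_measure mG1 mG2 indep12 mX) /product_measure1.
set c := P [set t | forall i, A i (S i t)].
(* For a fixed message [x] in [C], the section is a box event for the shifted key, whose probability
   [c] does not depend on [x]. *)
transitivity (\int[submeasure P mG1]_x (c * (\1_C x)%:E))%E.
  apply: eq_integral => x _ /=; rewrite indicE.
  have [xC|xC] := boolP (x \in C); last first.
    rewrite mule0 (_ : xsection X x = set0); first exact: measure0.
    apply/seteqP; split=> // y; rewrite /xsection/= inE => -[_ /= Cx].
    by rewrite notin_setE in xC.
  rewrite mule1 /c -(shiftS (fun i => V i x) mA); apply: congr1.
  apply/seteqP; split=> y; rewrite /xsection/= inE.
    by move=> [h _] i; rewrite addrC; exact: h.
  move=> h; split; last by rewrite inE in xC.
  by move=> i /=; rewrite addrC; exact: h.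
rewrite (@ge0_integralZl _ T1 R (submeasure P mG1) setT)//.
- by rewrite (@integral_indic _ T1)// setIT.
- by apply/measurable_EFinP; exact: (@measurable_indic _ T1 R setT C).
- exact: measure_ge0.
Qed.

End masking.

(** * Law of the keys *)

Section keys.
Context {R : realType} {dT : measure_display} {T : measurableType dT}.
Variable P : probability T R.

(** Full rank over the rationals passes to the reals through [ratr]; the inverse matrix is then
    applied separately for each second index [d]. *)
Lemma int_mx_solve n D (M : 'M[int]_n) (v : 'I_n * 'I_D -> R) :
  row_free (map_mx (fun x : int => x%:~R : rat) M) ->
  exists u : 'I_n * 'I_D -> R,
    forall q, \sum_(i < n) (M q.1 i)%:~R * u (i, q.2) = v q.
Proof.
rewrite row_free_unit => Mu; pose MR : 'M[R]_n := map_mx intr M.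
have MRu : MR \in unitmx.
  rewrite -(map_unitmx (@ratr R)) -map_mx_comp in Mu.
  rewrite (_ : MR = map_mx (ratr \o (fun x : int => x%:~R : rat)) M)//.
  by apply/matrixP => i j; rewrite !mxE/= ratr_int.
exists (fun p => (invmx MR *m \col_j v (j, p.2)) p.1 0) => -[j d] /=.
transitivity ((MR *m (invmx MR *m \col_j v (j, d))) j 0).
  by rewrite mxE; apply: eq_bigr => i _; rewrite !mxE.
by rewrite mulKVmx// mxE.
Qed.

(* The law of [M N mod 1] is translation invariant: a translation [v] of
   [M N] is the image of the translation [M^-1 v] of [N], and [M] is integral,
   so reducing [N + M^-1 v] modulo 1 first does not matter. *)
Lemma key_shift n D (M : 'M[int]_n) (N : 'I_n -> 'I_D -> T -> R)
    (v : 'I_n * 'I_D -> R) (A : 'I_n * 'I_D -> set R) :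
  row_free (map_mx (fun x : int => x%:~R : rat) M) ->
  (forall i d, measurable_fun setT (N i d)) ->
  mutually_indep P (fun p : 'I_n * 'I_D => N p.1 p.2) ->
  (forall i d, unif_half P (N i d)) ->
  (forall q, measurable (A q)) ->
  P [set t | forall q : 'I_n * 'I_D, A q (modone
      (modone (\sum_(i < n) (M q.1 i)%:~R * N i q.2 t) + v q))] =
  P [set t | forall q : 'I_n * 'I_D, A q (modone
      (\sum_(i < n) (M q.1 i)%:~R * N i q.2 t))].
Proof.
move=> Mfree mN iN uN mA; have [u uv] := int_mx_solve v Mfree.
pose F (q : 'I_n * 'I_D) (x : 'I_n * 'I_D -> R) : R :=
  modone (\sum_(i < n) (M q.1 i)%:~R * x (i, q.2)).
pose B : set ('I_n * 'I_D -> R) := [set x | forall q, A q (F q x)].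
have GB : <<s @boxes R ('I_n * 'I_D)%type >> B.
  apply: (@measurable_forall R _ _ (g_sigma_algebraType (@boxes R _)) F A) => // q.
  apply: (measurableT_comp measurable_modone).
  apply: measurable_sum => i; apply: measurable_funM => //.
  exact: measurable_coord.
rewrite [RHS](_ : _ = P [set t | B (fun p => N p.1 p.2 t)])//.
rewrite -(unif_joint_shift u (fun p => mN p.1 p.2) iN (fun p => uN p.1 p.2) GB).
congr (P _); apply/seteqP.
suff E q t : modone (modone (\sum_(i < n) (M q.1 i)%:~R * N i q.2 t) + v q) =
    F q (fun p => modone (N p.1 p.2 t + u p)).
  by split=> t /= h q; [rewrite -E; exact: h|rewrite E; exact: h].
rewrite modone_modoneD /F.
pose m i := sval (cid (modone_int_diff (N i q.2 t + u (i, q.2)))).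
have mE i : modone (N i q.2 t + u (i, q.2)) =
    N i q.2 t + u (i, q.2) + (m i)%:~R by rewrite /m; case: cid.
apply/esym; apply: (@modone_eq _ _ _ (\sum_(i < n) M q.1 i * m i)).
rewrite -uv -big_split/= rmorph_sum/= -big_split/=.
by apply: eq_bigr => i _; rewrite mE intrM; lra.
Qed.

End keys.

(** * Sigma-algebras generated by families of random variables *)

Section sigma_of.
Context {R : realType} {dT : measure_display} {T : measurableType dT}.

Lemma measurable_sigma_of (I : Type) (X : I -> T -> R) i :
  measurable_fun setT (X i : g_sigma_algebraType (rvsets X) -> R).
Proof.
by move=> _ A mA; rewrite setTI; apply: sub_sigma_algebra; exists i, A.
Qed.

Lemma rvsets_sub (I : Type) (X : I -> T -> R) (G : set (set T)) :
  (forall i, measurable_fun setT (X i : g_sigma_algebraType G -> R)) ->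
  rvsets X `<=` <<s G >>.
Proof.
move=> mX _ [i [A [mA ->]]]; have := mX i (@measurableT _ _) A mA.
by rewrite setTI.
Qed.

Lemma sigma_of_sub (I : Type) (X : I -> T -> R) (G : set (set T)) :
  (forall i, measurable_fun setT (X i : g_sigma_algebraType G -> R)) ->
  sigma_of X `<=` <<s G >>.
Proof.
move=> mX; apply: smallest_sub; first exact: smallest_sigma_algebra.
exact: rvsets_sub.
Qed.

Lemma rvsets_measurable (I : Type) (X : I -> T -> R) :
  (forall i, measurable_fun setT (X i)) -> rvsets X `<=` measurable.
Proof.
move=> mX _ [i [A [mA ->]]]; rewrite -[X in measurable X]setTI; exact: mX.
Qed.

Lemma measurable_fun_sigma_le (G1 G2 : set (set T)) (f : T -> R) :
  <<s G1 >> `<=` <<s G2 >> ->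
  measurable_fun setT (f : g_sigma_algebraType G1 -> R) ->
  measurable_fun setT (f : g_sigma_algebraType G2 -> R).
Proof. by move=> G12 mf _ A mA; apply: G12; exact: mf. Qed.

End sigma_of.
Arguments measurable_sigma_of {R dT T I} X i.

(** * Cancellation of the keys modulo 1 *)

Section integer_congruence.
Context {R : realType}.

Lemma modone_congr (x y : R) : x - y \is a Num.int -> modone x = modone y.
Proof. by move=> /intrP[n xy]; apply: (@modone_eq _ _ _ n); lra. Qed.

Lemma modoneB_int (x : R) : modone x - x \is a Num.int.
Proof.
by have [n ->] := modone_int_diff x; rewrite addrAC subrr add0r intr_int.
Qed.

(* The keys cancel modulo 1, so the last masked message is determined by the
   other ones. *)
Lemma last_masked (K : nat) (k l : 'I_K) (w s : 'I_K -> R) : l != k ->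
  \sum_j s j \is a Num.int ->
  modone (w l + s l) = modone (\sum_j w j - w k - s k -
    \sum_(j | (j != k) && (j != l)) modone (w j + s j)).
Proof.
move=> lk sint; apply: modone_congr.
rewrite (_ : _ - _ = \sum_j s j + \sum_(j | (j != k) && (j != l))
    (modone (w j + s j) - (w j + s j))).
  by rewrite rpredD// rpred_sum// => j _; exact: modoneB_int.
have sumE (F : 'I_K -> R) : \sum_j F j =
    F k + (F l + \sum_(j | (j != k) && (j != l)) F j).
  by rewrite (bigD1 k)//= (bigD1 l).
by rewrite [X in _ = _ + X]sumrB [X in _ = _ + (_ - X)]big_split/= !sumE; lra.
Qed.

(** Before reduction the sum is 0 because the columns of [G] sum to 0, and each reduction adds an
    integer. *)
Lemma sum_keys_int n K (G : 'M[int]_(K, n)) (x : 'I_n -> R) :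
  (forall i, \sum_(j < K) G j i = 0) ->
  \sum_(j < K) modone (\sum_(i < n) (G j i)%:~R * x i) \is a Num.int.
Proof.
move=> G0; pose a j : R := \sum_(i < n) (G j i)%:~R * x i.
have a0 : \sum_(j < K) a j = 0.
  rewrite exchange_big/= big1// => i _.
  by rewrite -mulr_suml -rmorph_sum/= G0 mul0r.
rewrite (_ : \sum_(j < K) _ = \sum_(j < K) (modone (a j) - a j)).
  by rewrite rpred_sum// => j _; exact: modoneB_int.
by rewrite [RHS]sumrB a0 subr0.
Qed.

End integer_congruence.

(** * Secrecy of the messages against a curious client *)

Theorem theorem2 (R : realType) (dT : measure_display) (T : measurableType dT)
  (P : probability T R)
  (K D : nat) (hK : (3 <= K)%N) (hD : (1 <= D)%N)
  (* i.i.d. key-generating noise N_1..N_{K-1}, each in [-1/2,1/2)^D *)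
  (Nn : 'I_K.-1 -> 'I_D -> T -> R)
  (* the integer generator matrix G_S *)
  (GS : 'M[int]_(K, K.-1))
  (* private messages W_1..W_K *)
  (W : 'I_K -> 'I_D -> T -> R)
  (a Pw N0 : R)
  (* transmit channel coefficients h_k (deterministic, nonzero) *)
  (h : 'I_K -> R)
  (* the fixed (honest-but-curious) client k *)
  (k : 'I_K)
  (* channel coefficients h_{k,k'} and receiver noises z_{k,k'} *)
  (hc : 'I_K -> T -> R) (z : 'I_K -> 'I_D -> T -> R) :
  (* keys S_k = [G_S N] mod 1 *)
  let S : 'I_K -> 'I_D -> T -> R := fun j d t =>
    modone (\sum_(i < K.-1) (GS j i)%:~R * Nn i d t) in
  (* aggregated message W = sum_k W_k *)
  let Wsum : 'I_D -> T -> R := fun d t => \sum_(j < K) W j d t in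
  (* e_k = [W_k + S_k] mod 1 *)
  let e : 'I_K -> 'I_D -> T -> R := fun j d t => modone (W j d t + S j d t) in
  (* y_{k,k'} = h_{k,k'} x_{k'} + z_{k,k'} with x_{k'} = sqrt P / h_{k'} e_{k'} *)
  let y : 'I_K -> 'I_D -> T -> R := fun j d t =>
    hc j t * (Num.sqrt Pw / h j * e j d t) + z j d t in
  (* measurability *)
  (forall i d, measurable_fun setT (Nn i d)) ->
  (forall j d, measurable_fun setT (W j d)) ->
  (forall j, j != k -> measurable_fun setT (hc j)) ->
  (forall j d, j != k -> measurable_fun setT (z j d)) ->
  (* N_1..N_{K-1} i.i.d. uniform on [-1/2,1/2)^D *)
  mutually_indep P (fun p : 'I_K.-1 * 'I_D => Nn p.1 p.2) ->
  (forall i d, unif_half P (Nn i d)) ->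
  (* any K-1 rows of G_S form a full-rank matrix *)
  (forall f : 'I_K.-1 -> 'I_K, injective f ->
     row_free (map_mx (fun x : int => x%:~R : rat) (rowsub f GS))) ->
  (* 1_K^T G_S = 0^T *)
  (forall i : 'I_K.-1, \sum_(j < K) GS j i = 0) ->
  (* messages independent of the keys *)
  indep_sigma P (sigma_of (fun p : 'I_K * 'I_D => W p.1 p.2))
                (sigma_of (fun p : 'I_K * 'I_D => S p.1 p.2)) ->
  (* W in [-a,a]^D with 0 < a < 1/2 *)
  0 < a -> a < 2^-1 ->
  (forall d t, `|Wsum d t| <= a) ->
  (* P > 0, h_k nonzero *)
  0 < Pw -> (forall j, h j != 0) ->
  (* z_{k,k'} ~ N(0, N0 I_D) *)
  0 < N0 ->
  (forall j, j != k -> mutually_indep P (fun d : 'I_D => z j d)) ->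
  (forall j d, j != k -> normal_law P 0 N0 (z j d)) ->
  (* channel coefficients and noises independent of messages and keys *)
  indep_sigma P
    (sigma_of (fun s : {j : 'I_K | j != k} + ({j : 'I_K | j != k} * 'I_D) =>
       match s with inl j => hc (val j) | inr p => z (val p.1) p.2 end))
    (sigma_of (fun s : ('I_K * 'I_D) + ('I_K * 'I_D) =>
       match s with inl p => W p.1 p.2 | inr p => S p.1 p.2 end)) ->
  (* I({W_k'}_{k'<>k} ; {y_{k,k'}}_{k'<>k} | W_k, S_k, W) = 0 *)
  cond_mutual_info P
    (sigma_of (fun p : {j : 'I_K | j != k} * 'I_D => W (val p.1) p.2))
    (sigma_of (fun p : {j : 'I_K | j != k} * 'I_D => y (val p.1) p.2))
    (sigma_of (fun s : 'I_D + 'I_D + 'I_D =>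
       match s with
       | inl (inl d) => W k d
       | inl (inr d) => S k d
       | inr d => Wsum d
       end)) = (0%R)%:E.
Proof.
move=> S Wsum e y mN mW mhc mz iN uN Gfree G0 indepWS _ _ _ _ _ _ _ _ indepNoise.
have [l lk] : exists l : 'I_K, l != k.
  have K1 : (1 < K)%N by exact: leq_trans hK.
  have [->|k0] := eqVneq k (Ordinal (ltnW K1)); first by exists (Ordinal K1).
  by exists (Ordinal (ltnW K1)); rewrite eq_sym.
pose Wf (p : 'I_K * 'I_D) := W p.1 p.2.
pose Sf (p : 'I_K * 'I_D) := S p.1 p.2.
pose WSf (s : ('I_K * 'I_D) + ('I_K * 'I_D)) :=
  match s with inl p => W p.1 p.2 | inr p => S p.1 p.2 end.
pose Cf (s : {j : 'I_K | j != k} + ({j : 'I_K | j != k} * 'I_D)) :=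
  match s with inl j => hc (val j) | inr p => z (val p.1) p.2 end.
pose Hf (s : 'I_D + 'I_D) := match s with inl d => W k d | inr d => Wsum d end.
have mS j d : measurable_fun setT (S j d).
  apply: (measurableT_comp measurable_modone).
  by apply: measurable_sum => i; exact: measurable_funM.
have mWG : rvsets Wf `<=` measurable by apply: rvsets_measurable => p; exact: mW.
have mSG : rvsets Sf `<=` measurable by apply: rvsets_measurable => p; exact: mS.
have mCG : rvsets Cf `<=` measurable.
  apply: rvsets_measurable => -[j|p]; first exact: mhc (valP j).
  exact: mz (valP p.1).
have mWSG : rvsets WSf `<=` measurable.
  by apply: rvsets_measurable => -[p|p]; [exact: mW|exact: mS].
(* [lift l] enumerates the clients other than [l]. The message of [k] is replaced by 0, so that the
   corresponding entry of [U] is the key of [k] itself. *)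
pose V (q : 'I_K.-1 * 'I_D) : T -> R :=
  if lift l q.1 == k then cst 0 else W (lift l q.1) q.2.
pose S' (q : 'I_K.-1 * 'I_D) := S (lift l q.1) q.2.
pose U q t := modone (V q t + S' q t).
have mVW q : measurable_fun setT (V q : g_sigma_algebraType (rvsets Wf) -> R).
  rewrite /V; case: ifP => _; first exact: measurable_cst.
  exact: (measurable_sigma_of Wf (lift l q.1, q.2)).
have mS'S q : measurable_fun setT (S' q : g_sigma_algebraType (rvsets Sf) -> R).
  exact: (measurable_sigma_of Sf (lift l q.1, q.2)).
have shiftS' v (A : 'I_K.-1 * 'I_D -> set R) : (forall q, measurable (A q)) ->
    P [set t | forall q, A q (modone (S' q t + v q))] =
    P [set t | forall q, A q (S' q t)].
  move=> mA; have := @key_shift R _ T P _ D (rowsub (lift l) GS) Nn v A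
    (Gfree _ (@lift_inj _ l)) mN iN uN mA.
  have SE q t : modone (\sum_(i < K.-1)
      (rowsub (lift l) GS q.1 i)%:~R * Nn i q.2 t) = S' q t.
    by congr modone; apply: eq_bigr => i _; rewrite mxE.
  have -> : [set t | forall q : 'I_K.-1 * 'I_D, A q (modone (modone
      (\sum_(i < K.-1) (rowsub (lift l) GS q.1 i)%:~R * Nn i q.2 t) + v q))] =
      [set t | forall q, A q (modone (S' q t + v q))].
    by apply/seteqP; split=> t /= tA q; have := tA q; rewrite SE.
  have -> : [set t | forall q : 'I_K.-1 * 'I_D, A q (modone
      (\sum_(i < K.-1) (rowsub (lift l) GS q.1 i)%:~R * Nn i q.2 t))] =
      [set t | forall q, A q (S' q t)].
    by apply/seteqP; split=> t /= tA q; have := tA q; rewrite SE.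
  by [].
have sWWS : <<s rvsets Wf >> `<=` <<s rvsets WSf >>.
  apply: (sigma_of_sub (X := Wf)) => p.
  exact: (measurable_sigma_of WSf (inl p)).
have sSWS : <<s rvsets Sf >> `<=` <<s rvsets WSf >>.
  apply: (sigma_of_sub (X := Sf)) => p.
  exact: (measurable_sigma_of WSf (inr p)).
have mUWS q : measurable_fun setT (U q : g_sigma_algebraType (rvsets WSf) -> R).
  apply: (measurableT_comp measurable_modone); apply: measurable_funD.
    exact: measurable_fun_sigma_le (mVW q).
  exact: measurable_fun_sigma_le (mS'S q).
pose Ubox (A : 'I_K.-1 * 'I_D -> set R) := [set t | forall q, A q (U q t)].
have UboxWS A : (forall q, measurable (A q)) -> <<s rvsets WSf >> (Ubox A).
  exact: (@measurable_forall R _ _ (g_sigma_algebraType (rvsets WSf)) U A).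
have UW A C : (forall q, measurable (A q)) -> <<s rvsets Wf >> C ->
    Pr P (Ubox A `&` C) = Pr P (Ubox A) * Pr P C.
  move=> mA GC.
  have mU : measurable (Ubox A) := g_sigma_algebra_sub mWSG (UboxWS A mA).
  have mC : measurable C := g_sigma_algebra_sub mWG GC.
  have mb := masked_box mWG mSG indepWS mVW mS'S shiftS' mA.
  apply: EFin_inj; rewrite EFinM -!PrE//; last exact: measurableI.
  rewrite mb//; congr (_ * _)%E.
  (* The case [C = setT] shows that [U] has the law of the keys. *)
  have := mb setT (@measurableT _ (g_sigma_algebraType (rvsets Wf))).
  by rewrite setIT probability_setT mule1.
(* A pi-system for [U] jointly with the channel coefficients and the noises. *)
pose LG : set (set T) := [set E | exists A C,
  [/\ forall q, measurable (A q), <<s rvsets Cf >> C & E = Ubox A `&` C]].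
have LGT : LG setT.
  exists (fun=> setT), setT; split=> //.
    exact: (@measurableT _ (g_sigma_algebraType _)).
  by apply/seteqP; split=> t.
have mLG : LG `<=` measurable.
  move=> _ [A [C [mA GC ->]]]; apply: measurableI.
    exact: g_sigma_algebra_sub mWSG _ (UboxWS A mA).
  exact: g_sigma_algebra_sub mCG _ GC.
have LGI : setI_closed LG.
  move=> _ _ [A [C [mA GC ->]]] [B [E [mB GE ->]]].
  exists (fun q => A q `&` B q), (C `&` E); split.
  - by move=> q; exact: measurableI.
  - exact: (@measurableI _ (g_sigma_algebraType _)).
  - rewrite setIACA; congr (_ `&` _); apply/seteqP; split=> t /=.
      by move=> [hA hB] q; split.
    by move=> tAB; split=> q; have [] := tAB q.
have indepLW : indep_sigma P <<s LG >> <<s rvsets Wf >>.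
  apply: indep_sigma_pi_system => //; first exact: g_sigma_algebra_sub.
  move=> _ B [A [C [mA GC ->]]] WB.
  (* First [C] is split off from [Ubox A & B], an event about messages and keys; then [UW] separates
     [Ubox A] from [B]. *)
  rewrite (setIC _ C) -setIA !(indepNoise C)//.
  - by rewrite UW// mulrA.
  - exact: UboxWS.
  - apply: (@measurableI _ (g_sigma_algebraType (rvsets WSf))).
      exact: UboxWS.
    exact: sWWS.
have HW : rvsets Hf `<=` <<s rvsets Wf >>.
  apply: rvsets_sub => -[d|d]; first exact: (measurable_sigma_of Wf (k, d)).
  by apply: measurable_sum => j; exact: (measurable_sigma_of Wf (j, d)).
(* It remains to see that the key of [k] and all received signals are measurable for the
   sigma-algebra generated by [U], the channels, the noises, [W k] and [Wsum]. *)
pose GG := rectangles LG (rvsets Hf).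
have mHG s : measurable_fun setT (Hf s : g_sigma_algebraType GG -> R).
  apply: measurable_fun_sigma_le (measurable_sigma_of Hf s).
  exact: rectanglesr.
have mLGG f : measurable_fun setT (f : g_sigma_algebraType LG -> R) ->
    measurable_fun setT (f : g_sigma_algebraType GG -> R).
  by apply: measurable_fun_sigma_le; exact: rectanglesl.
have mUG q : measurable_fun setT (U q : g_sigma_algebraType GG -> R).
  apply: mLGG => _ B mB; rewrite setTI; apply: sub_sigma_algebra.
  exists (fun q' => if q' == q then B else setT), setT; split.
  - by move=> q'; case: ifP.
  - exact: (@measurableT _ (g_sigma_algebraType _)).
  - rewrite setIT; apply/seteqP; split=> t /=.
      by move=> tB q'; case: eqP => // ->.
    by move=> /(_ q); rewrite eqxx.
have mCfG s : measurable_fun setT (Cf s : g_sigma_algebraType GG -> R).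
  apply: mLGG => _ B mB; rewrite setTI; apply: sub_sigma_algebra.
  exists (fun=> setT), (Cf s @^-1` B); split=> //.
    by apply: sub_sigma_algebra; exists s, B.
  by apply/seteqP; split=> t // [].
have mSkG d : measurable_fun setT (S k d : g_sigma_algebraType GG -> R).
  have [i ki|ki] := unliftP l k; last by rewrite ki eqxx in lk.
  rewrite (_ : S k d = U (i, d)); first exact: mUG.
  (* Keys are already reduced, so reducing them again changes nothing. *)
  apply/funext => t; rewrite /U /V /S' /= -ki eqxx add0r modone_id//.
  exact: modone_itv.
have me j d : j != k -> j != l ->
    measurable_fun setT (e j d : g_sigma_algebraType GG -> R).
  move=> jk jl; have [i ji|ji] := unliftP l j; last by rewrite ji eqxx in jl.
  rewrite (_ : e j d = U (i, d)); first exact: mUG.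
  by apply/funext => t; rewrite /U /V /S' /= -ji (negPf jk).
have mel d : measurable_fun setT (e l d : g_sigma_algebraType GG -> R).
  rewrite (_ : e l d = fun t => modone (Wsum d t - W k d t - S k d t -
      \sum_(j | (j != k) && (j != l)) e j d t)).
    apply: (measurableT_comp measurable_modone).
    apply: measurable_funB; last first.
      rewrite (_ : (fun t => _) = (fun t => \sum_(j < K)
          (if (j != k) && (j != l) then e j d t else 0))); last first.
        by apply/funext => t; rewrite big_mkcond.
      apply: measurable_sum => j.
      case: (boolP ((j != k) && (j != l))) => [/andP[jk jl]|_].
        exact: me.
      exact: measurable_cst.
    apply: measurable_funB => //; apply: measurable_funB.
      exact: (mHG (inr d)).
    exact: (mHG (inl d)).
  apply/funext => t.
  apply: (@last_masked R K k l (fun j => W j d t) (fun j => S j d t) lk).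
  exact: sum_keys_int.
have sT (I : Type) (X : I -> T -> R) : sigma_of X setT.
  exact: (@measurableT _ (g_sigma_algebraType (rvsets X))).
apply: (cond_mutual_info_eq0 mWG mLG HW indepLW) => //.
- by apply: sigma_of_sub => p; exact: (measurable_sigma_of Wf (val p.1, p.2)).
- apply: (sigma_of_sub (X := Hf)) => -[d|d].
    exact: (@measurable_sigma_of _ _ _ _ _ (inl (inl d))).
  exact: (@measurable_sigma_of _ _ _ _ _ (inr d)).
- apply: sigma_of_sub => -[j d] /=.
  apply: measurable_funD; last exact: (mCfG (inr (j, d))).
  apply: measurable_funM; first exact: (mCfG (inl j)).
  apply: measurable_funM; first exact: measurable_cst.
  have [->|jl] := eqVneq (val j) l; first exact: mel.
  exact: me (valP j) jl.
- apply: sigma_of_sub => -[[d|d]|d] //.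
    exact: (mHG (inl d)).
  exact: (mHG (inr d)).
Qed.
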